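(* Let $\mathbb{L}=(\mathcal{P},\mathcal{C},\parallel)$ be a miquelian Laguerre plane (of arbitrary characteristic). Let $a,b,c,x$ be pairwise non-parallel points with $x\notin(a,b,c)^{\circ}$, and let $p,q$ be points such that $p\parallel c$, $p\in(a,b,x)^{\circ}$, $q\parallel b$, $q\in(a,c,x)^{\circ}$. Then the circle tangent to $(q,p,x)^{\circ}$ at $p$ and passing through $b$ is tangent to $(a,b,c)^{\circ}$ at $b$.
   Context: A Laguerre plane is a triple $(\mathcal{P},\mathcal{C},\parallel)$ where $\mathcal{P}$ is a set of points, $\mathcal{C}\subset 2^{\mathcal{P}}$ a set of circles and $\parallel$ an equivalence relation on $\mathcal{P}$ (parallelism; its classes are called generators) such that: (1) any three pairwise non-parallel points $a,b,c$ lie on a unique circle, denoted $(a,b,c)^{\circ}$; (2) for every circle $K$ and non-parallel points $p\in K$, $q\notin K$ there is exactly one circle $L$ with $q\in L$ and $K\cap L=\{p\}$; (3) for every point $p$ and circle $K$ there is exactly one point $q\in K$ with $q\parallel p$; (4) some circle contains at least three but not all points. Circles $K,L$ are tangent at $p$ if $K\cap L=\{p\}$ or $K=L$ (with $p\in K$). A quadruple $(a,b,c,d)$ of points is concyclic, written $(a,b,c,d)_{\triangle}$, if $a,b,c,d$ lie on a common circle, or $a\parallel b$, $c\parallel d$ and $a\nparallel c$. The plane is miquelian if for any eight distinct points $a,b,c,d,e,f,g,h$, the relations $(a,c,b,d)_{\triangle}$, $(a,e,b,h)_{\triangle}$, $(a,g,d,h)_{\triangle}$, $(b,f,c,e)_{\triangle}$,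 $(c,g,d,f)_{\triangle}$ imply $(e,g,f,h)_{\triangle}$. *)

(* Defs.v *)
From Stdlib Require Import RelationClasses.

(* Circles are sets of points, i.e. predicates on the point type [P];
   the circle set [C] is a predicate on such sets. Two sets are the same
   circle iff they have the same points ([same_set]). *)
Definition pset (P : Type) := P -> Prop.

Definition same_set {P : Type} (K L : pset P) : Prop := forall z, K z <-> L z.

Section Laguerre.
Variables (P : Type) (C : pset P -> Prop) (par : P -> P -> Prop).

Definition pw_nonpar3 (a b c : P) : Prop :=
  ~ par a b /\ ~ par a c /\ ~ par b c.

Definition laguerre_plane : Prop :=
  Equivalence par /\
  (forall a b c, pw_nonpar3 a b c ->
     exists K, C K /\ K a /\ K b /\ K c /\
       forall L, C L -> L a -> L b -> L c -> same_set K L) /\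
  (forall K p q, C K -> ~ par p q -> K p -> ~ K q ->
     exists L, C L /\ L q /\ (forall z, (K z /\ L z) <-> z = p) /\
       forall L', C L' -> L' q -> (forall z, (K z /\ L' z) <-> z = p) ->
         same_set L L') /\
  (forall p K, C K -> exists q, K q /\ par q p /\
       forall q', K q' -> par q' p -> q' = q) /\
  (exists K, C K /\ (exists x y z, K x /\ K y /\ K z /\ x <> y /\ x <> z /\ y <> z)
     /\ exists w, ~ K w).

Definition tangent_at (K L : pset P) (p : P) : Prop :=
  K p /\ L p /\ ((forall z, (K z /\ L z) <-> z = p) \/ same_set K L).

Definition concyclic (a b c d : P) : Prop :=
  (exists K, C K /\ K a /\ K b /\ K c /\ K d) \/
  (par a b /\ par c d /\ ~ par a c).

Definition miquelian : Prop :=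
  forall a b c d e f g h : P,
    a <> b -> a <> c -> a <> d -> a <> e -> a <> f -> a <> g -> a <> h ->
    b <> c -> b <> d -> b <> e -> b <> f -> b <> g -> b <> h ->
    c <> d -> c <> e -> c <> f -> c <> g -> c <> h ->
    d <> e -> d <> f -> d <> g -> d <> h ->
    e <> f -> e <> g -> e <> h ->
    f <> g -> f <> h ->
    g <> h ->
    concyclic a c b d -> concyclic a e b h -> concyclic a g d h ->
    concyclic b f c e -> concyclic c g d f ->
    concyclic e g f h.

End Laguerre.

Arguments pw_nonpar3 {P} par a b c.
Arguments laguerre_plane {P} C par.
Arguments tangent_at {P} K L p.
Arguments concyclic {P} C par a b c d.
Arguments miquelian {P} C par.

(* Main.v *)
(** Write K = (a,b,c), K' = (q,p,x), U = (a,b,x), V = (a,c,x), and let L be the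
    circle through b tangent to K' at p. Suppose L meets K again at y. Miquel's
    condition applied to the cube a; b,c,x; t,p,q,z says, for a circle M through
    b and p meeting K at t and K' at z with t <> z, that c,q,t,z are concyclic;
    conversely a second common point of M and (c,q,t) lies on K', and a second
    common point of M and (c,q,z) lies on K.

    If y is parallel to x, the degenerate case of Miquel's condition yields a
    point of L and K' other than p. Otherwise the obstacle is that (c,q,y) may
    be tangent to L at y. It is overcome by varying q: let x1 be the point of
    U parallel to y, q1 the point of (a,c,x1) parallel to b, and K1' =
    (q1,p,x1). For this second configuration the same degenerate case yields a
    point of L and K1' other than p, so K' and K1' are not tangent at p and
    share a point z <> p. For M = (b,p,z), a further point of M and K would
    lie on both (c,q,z) and (c,q1,z), so both these circles are tangent to M
    at z. Hence they coincide and q = q1, which is absurd. *)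

Require Import Defs.
From Stdlib Require Import Classical.

Section Plane.
Context {P : Type} {C : pset P -> Prop} {par : P -> P -> Prop}.
Context (HL : laguerre_plane C par).

(** * Incidence in a Laguerre plane *)

Lemma par_refl u : par u u.
Proof. apply HL. Qed.

Lemma par_sym u v : par u v -> par v u.
Proof. apply HL. Qed.

Lemma par_trans u v w : par u v -> par v w -> par u w.
Proof. apply HL. Qed.

Lemma circle_through u v w : ~ par u v -> ~ par u w -> ~ par v w ->
  exists K, C K /\ K u /\ K v /\ K w.
Proof.
intros uv uw vw.
destruct HL as (_ & H & _).
destruct (H u v w) as (K & CK & Ku & Kv & Kw & _); [now repeat split|].
now exists K.
Qed.

Lemma circle_meets K u : C K -> exists v, K v /\ par v u.
Proof.
intros CK. destruct HL as (_ & _ & _ & H & _).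
destruct (H u K CK) as (v & Kv & vu & _). now exists v.
Qed.

Lemma circle_par_eq K u v : C K -> K u -> K v -> par u v -> u = v.
Proof.
intros CK Ku Kv uv. destruct HL as (_ & _ & _ & H & _).
destruct (H v K CK) as (w & Kw & wv & Hw).
now rewrite (Hw u Ku uv), (Hw v Kv (par_refl v)).
Qed.

Lemma circle_eq K L u v w : C K -> C L -> u <> v -> u <> w -> v <> w ->
  K u -> K v -> K w -> L u -> L v -> L w -> same_set K L.
Proof.
intros CK CL uv uw vw Ku Kv Kw Lu Lv Lw.
destruct HL as (_ & H & _).
destruct (H u v w) as (J & _ & _ & _ & _ & HJ).
{ repeat split; intros E; [apply uv|apply uw|apply vw];
  now apply (circle_par_eq K). }
intros z. now rewrite <- (HJ K CK Ku Kv Kw z), <- (HJ L CL Lu Lv Lw z).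
Qed.

Lemma tangent_unique K L L' u v : C K -> C L -> C L' ->
  ~ par u v -> ~ K v -> K u -> L u -> L' u -> L v -> L' v ->
  (forall z, K z -> L z -> z = u) -> (forall z, K z -> L' z -> z = u) ->
  same_set L L'.
Proof.
intros CK CL CL' uv nKv Ku Lu L'u Lv L'v HLu HL'u.
destruct HL as (_ & _ & H & _).
destruct (H K u v CK uv Ku nKv) as (J & _ & _ & _ & HJ).
assert (E : same_set J L).
{ apply HJ; trivial. intros z. split; [intros []; auto|now intros ->]. }
assert (E' : same_set J L').
{ apply HJ; trivial. intros z. split; [intros []; auto|now intros ->]. }
intros z. now rewrite <- (E z), <- (E' z).
Qed.

Lemma not_par_neq u v : ~ par u v -> u <> v.
Proof. intros H ->. apply H, par_refl. Qed.

(** For the 28 inequalities in Miquel's condition: two points differ if they are not parallel or if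
    some circle contains only one of them. *)
Ltac neq :=
  solve [ auto using not_par_neq, par_sym
        | match goal with
          | H : ?J ?u, H' : ~ ?J ?v |- ?u <> ?v =>
              exact (fun E => H' (eq_ind _ J H _ E))
          | H : ?J ?u, H' : ~ ?J ?v |- ?v <> ?u =>
              exact (fun E => H' (eq_ind_r J H E))
          end ].

(* Notation of the header; invariant under the exchange a-x, b-p, c-q, K-K'. *)
Variant config (a b c x p q : P) (K K' U V : pset P) : Prop := Config
  (nab : ~ par a b) (nac : ~ par a c) (nax : ~ par a x) (nbc : ~ par b c)
  (nbx : ~ par b x) (ncx : ~ par c x) (CK : C K) (Ka : K a) (Kb : K b)
  (Kc : K c) (nKx : ~ K x) (CU : C U) (Ua : U a) (Ub : U b) (Ux : U x)
  (Up : U p) (CV : C V) (Va : V a) (Vc : V c) (Vx : V x) (Vq : V q)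
  (ppc : par p c) (pqb : par q b) (CK' : C K') (K'q : K' q) (K'p : K' p)
  (K'x : K' x).

Variant derived (a b c x p q : P) (K K' U V : pset P) : Prop := Derived
  (nap : ~ par a p) (naq : ~ par a q) (nbp : ~ par b p) (ncq : ~ par c q)
  (nxp : ~ par x p) (nxq : ~ par x q) (npq : ~ par p q) (dpc : p <> c)
  (dqb : q <> b) (nKp : ~ K p) (nKq : ~ K q) (nK'a : ~ K' a) (nK'b : ~ K' b)
  (nK'c : ~ K' c) (K_U : forall z, K z -> U z -> z = a \/ z = b)
  (K'_U : forall z, K' z -> U z -> z = x \/ z = p)
  (U_V : forall z, U z -> V z -> z = a \/ z = x).

(** Everything follows from two facts: a circle meets each generator only once, and distinct circles
    share at most two points. *)
Lemma config_derived a b c x p q K K' U V :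
  config a b c x p q K K' U V -> derived a b c x p q K K' U V.
Proof.
intros [].
assert (nap : ~ par a p) by eauto using par_trans, par_sym.
assert (naq : ~ par a q) by eauto using par_trans, par_sym.
assert (nbp : ~ par b p) by eauto using par_trans, par_sym.
assert (ncq : ~ par c q) by eauto using par_trans, par_sym.
assert (nxp : ~ par x p) by eauto using par_trans, par_sym.
assert (nxq : ~ par x q) by eauto using par_trans, par_sym.
assert (npq : ~ par p q) by eauto 6 using par_trans, par_sym.
assert (K_U : forall z, K z -> U z -> z = a \/ z = b).
{ intros z Kz Uz. apply NNPP; intros E. apply nKx.
  apply (circle_eq K U a b z); auto using not_par_neq; intros ->; tauto. }
assert (dpc : p <> c).
{ intros ->. destruct (K_U c) as [->| ->]; auto using par_refl. }
assert (K_V : forall z, K z -> V z -> z = a \/ z = c).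
{ intros z Kz Uz. apply NNPP; intros E. apply nKx.
  apply (circle_eq K V a c z); auto using not_par_neq; intros ->; tauto. }
assert (dqb : q <> b).
{ intros ->. destruct (K_V b) as [->| ->]; auto using par_refl. }
assert (nK'b : ~ K' b) by (intros ?; apply dqb; now apply (circle_par_eq K')).
assert (nK'c : ~ K' c) by (intros ?; apply dpc; now apply (circle_par_eq K')).
assert (K'_U : forall z, K' z -> U z -> z = x \/ z = p).
{ intros z K'z Uz. apply NNPP; intros E. apply nK'b.
  apply (circle_eq K' U x p z); auto using not_par_neq; intros ->; tauto. }
constructor; trivial.
- intros ?; apply dpc; now apply (circle_par_eq K).
- intros ?; apply dqb; now apply (circle_par_eq K).
- intros K'a; destruct (K'_U a); trivial; subst; auto using par_refl.
- intros z Uz Vz. apply NNPP; intros E. apply dpc.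
  apply (circle_par_eq U); trivial.
  apply (circle_eq U V a x z); auto using not_par_neq; intros ->; tauto.
Qed.

(** Lets results that end on K' be reused to end on K. *)
Lemma config_swap a b c x p q K K' U V :
  config a b c x p q K K' U V -> config x p q a b c K' K U V.
Proof.
intros H; destruct (config_derived _ _ _ _ _ _ _ _ _ _ H), H.
constructor; auto using par_sym.
Qed.

Context (HM : miquelian C par).

(** * Miquel's condition for the circles through b and p *)

Section Miquel.
Context {a b c x p q : P} {K K' U V M : pset P}.
Context (Hc : config a b c x p q K K' U V) (CM : C M) (Mb : M b) (Mp : M p).

Lemma pencil_U z : U z -> M z -> z <> b -> z <> p -> same_set M U.
Proof.
intros Uz Mz zb zp. destruct (config_derived _ _ _ _ _ _ _ _ _ _ Hc), Hc.
apply (circle_eq M U b p z); auto using not_par_neq.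
Qed.

Lemma miquel_join t z :
  M t -> K t -> t <> b -> M z -> K' z -> z <> p -> t <> z ->
  exists N, C N /\ N c /\ N q /\ N t /\ N z.
Proof.
intros Mt Kt tb Mz K'z zp tz.
destruct (config_derived _ _ _ _ _ _ _ _ _ _ Hc), Hc.
(* The eight points are distinct unless M = U; in that case V is the required circle. *)
assert (HU : M a \/ M x -> t = a /\ z = x).
{ intros E. assert (MU : same_set M U).
  { destruct E; [apply (pencil_U a)|apply (pencil_U x)];
    auto using not_par_neq, par_sym. }
  destruct (K_U t Kt), (K'_U z K'z); try apply MU; trivial; tauto. }
destruct (classic (t = a)) as [->|ta].
{ destruct HU as [_ ->]; [now left|]. now exists V. }
assert (nMx : ~ M x) by tauto.
assert (nMc : ~ M c) by (intros ?; apply dpc; now apply (circle_par_eq M)).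
assert (nMq : ~ M q) by (intros ?; apply dqb; now apply (circle_par_eq M)).
assert (J : concyclic C par t q z c).
{ apply (HM a b p x t z q c).
  all: try neq.
  all: left.
  - now exists U.
  - now exists K.
  - now exists V.
  - now exists M.
  - now exists K'. }
(* The degenerate alternative makes z parallel to c, hence to p, and M contains both z and p. *)
destruct J as [(N & CN & ? & ? & ? & ?)|(_ & zc & _)]; [now exists N|].
destruct zp. apply (circle_par_eq M); trivial.
eauto using par_trans, par_sym.
Qed.

(** The same cube as in [miquel_join], with N now a given face and K' the concluding one. *)
Lemma miquel_transfer t r N :
  M t -> K t -> t <> b -> M r -> r <> t ->
  C N -> N c -> N q -> N t -> N r -> K' r.
Proof.
intros Mt Kt tb Mr rt CN Nc Nq Nt Nr.
destruct (config_derived _ _ _ _ _ _ _ _ _ _ Hc), Hc.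
assert (nMc : ~ M c) by (intros ?; apply dpc; now apply (circle_par_eq M)).
assert (nMq : ~ M q) by (intros ?; apply dqb; now apply (circle_par_eq M)).
assert (nNb : ~ N b) by (intros ?; apply dqb; now apply (circle_par_eq N)).
assert (nNp : ~ N p) by (intros ?; apply dpc; now apply (circle_par_eq N)).
(* If M = U, then t = a and N = V, so r is the other common point x of U and V. *)
destruct (classic (M a)) as [Ma|nMa].
{ assert (MU : same_set M U).
  { apply (pencil_U a); auto using not_par_neq. }
  destruct (K_U t) as [->|]; trivial; [now apply MU| |contradiction].
  assert (NV : same_set N V).
  { apply (circle_eq N V a c q); auto using not_par_neq. }
  destruct (U_V r) as [->| ->]; trivial; [now apply MU|now apply NV|easy]. }
destruct (classic (r = x)) as [->|rx]; trivial.
assert (J : concyclic C par p q r x).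
{ apply (HM a b t c p r q x).
  all: try neq.
  all: left.
  - now exists K.
  - now exists U.
  - now exists V.
  - now exists M.
  - now exists N. }
destruct J as [(J & CJ & ? & ? & ? & ?)|(? & _)]; [|contradiction].
apply (circle_eq J K' p q x); auto using not_par_neq, par_sym.
Qed.

(* All eight points lie on the generators of [a], [b], [c], [x], so both the
   faces [a r b q] and [c p x y] of the Miquel cube are concyclic in the
   degenerate sense. *)
Lemma miquel_four_generators y :
  par y x -> M y -> K y -> exists r, M r /\ K' r /\ r <> p.
Proof.
intros yx My Ky.
destruct (config_derived _ _ _ _ _ _ _ _ _ _ Hc), Hc.
destruct (circle_meets M a CM) as (r & Mr & ra).
(* Otherwise M = U, which meets the generator of x only in x, so y = x would lie on K. *)
assert (nMa : ~ M a).
{ intros Ma. assert (MU : same_set M U).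
  { apply (pencil_U a); auto using not_par_neq. }
  apply nKx. rewrite <- (circle_par_eq U y x); trivial. now apply MU. }
assert (nMc : ~ M c) by (intros ?; apply dpc; now apply (circle_par_eq M)).
assert (nMq : ~ M q) by (intros ?; apply dqb; now apply (circle_par_eq M)).
assert (nrb : ~ par r b) by eauto using par_trans, par_sym.
assert (nrc : ~ par r c) by eauto using par_trans, par_sym.
assert (nrx : ~ par r x) by eauto using par_trans, par_sym.
assert (nrp : ~ par r p) by eauto using par_trans, par_sym.
assert (nyb : ~ par y b) by eauto using par_trans, par_sym.
assert (nry : ~ par r y) by eauto using par_trans, par_sym.
assert (J : concyclic C par r c y q).
{ apply (HM a b p x r y c q).
  all: try neq.
  - left; now exists U.
  - right; repeat split; auto using par_sym.
  - left; now exists V.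
  - left; now exists M.
  - right; repeat split; auto using par_sym. }
destruct J as [(N & CN & ? & ? & ? & ?)|(? & _)]; [|contradiction].
exists r. repeat split; auto using not_par_neq.
apply (miquel_transfer y r N); auto using not_par_neq.
Qed.

End Miquel.


(** * The tangency at b *)

Lemma pencil_circle_tangent a b c x p q K K' U V L :
  config a b c x p q K K' U V -> C L -> L b -> L p ->
  (forall z, L z -> K' z -> z = p) -> forall y, L y -> K y -> y = b.
Proof.
intros Hc CL Lb Lp LK' y Ly Ky. apply NNPP; intros yb.
destruct (config_derived _ _ _ _ _ _ _ _ _ _ Hc).
pose proof Hc as [].
assert (yx : ~ par y x).
{ intros yx. destruct (miquel_four_generators Hc CL Lb Lp y yx Ly Ky)
    as (r & Lr & K'r & rp). auto. }
assert (nLa : ~ L a).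
{ intros La. assert (LU : same_set L U).
  { apply (pencil_U Hc CL Lb Lp a); auto using not_par_neq. }
  apply (not_par_neq x p); trivial. apply LK'; trivial. now apply LU. }
assert (ay : ~ par a y).
{ intros E. apply nLa. now rewrite (circle_par_eq K a y). }
assert (nyb : ~ par y b) by (intros ?; apply yb; now apply (circle_par_eq K)).
assert (nyc : ~ par y c).
{ intros E. apply dpc. rewrite <- (circle_par_eq K y c); trivial.
  apply (circle_par_eq L); eauto using par_trans, par_sym. }
destruct (circle_meets U y CU) as (x1 & Ux1 & x1y).
assert (nax1 : ~ par a x1) by eauto using par_trans, par_sym.
assert (nbx1 : ~ par b x1) by eauto using par_trans, par_sym.
assert (ncx1 : ~ par c x1) by eauto using par_trans, par_sym.
assert (nxx1 : ~ par x x1) by eauto using par_trans, par_sym.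
assert (nKx1 : ~ K x1).
{ intros Kx1. destruct (K_U x1); subst; auto using par_refl. }
destruct (circle_through a c x1) as (V1 & CV1 & V1a & V1c & V1x1); trivial.
destruct (circle_meets V1 b CV1) as (q1 & V1q1 & q1b).
assert (pq1 : ~ par p q1) by eauto 6 using par_trans, par_sym.
assert (x1q1 : ~ par x1 q1) by eauto 6 using par_trans, par_sym.
assert (x1p : ~ par x1 p) by eauto 6 using par_trans, par_sym.
destruct (circle_through p q1 x1) as (K1' & CK1' & K1'p & K1'q1 & K1'x1);
  auto using par_sym.
(* Both configurations share b, p, K and U, so one circle through b and p serves for both. *)
assert (Hc1 : config a b c x1 p q1 K K1' U V1) by now constructor.
destruct (config_derived _ _ _ _ _ _ _ _ _ _ Hc1)
  as [_ naq1 _ ncq1 _ _ _ _ dq1b _ _ nK1'a nK1'b nK1'c _ K1'_U _].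
(* If q = q1, then V and V1 share a, c, q and coincide, so x1 would be a or x. *)
assert (qq1 : q <> q1).
{ intros <-. destruct (U_V x1) as [->| ->]; auto using par_refl.
  apply (circle_eq V V1 a c q); auto using not_par_neq. }
destruct (miquel_four_generators Hc1 CL Lb Lp y) as (r & Lr & K1'r & rp);
  auto using par_sym.
(* Otherwise L and K1' both touch K' at p and share r, so they coincide and b lies on K1'. *)
assert (Hz : exists z, K' z /\ K1' z /\ z <> p).
{ apply NNPP; intros E. apply nK1'b.
  apply (tangent_unique K' L K1' p r); trivial.
  - intros pr. apply rp. symmetry. now apply (circle_par_eq L).
  - intros K'r. apply rp. auto.
  - auto.
  - intros z K'z K1'z. apply NNPP; intros zp. apply E. now exists z. }
destruct Hz as (z & K'z & K1'z & zp).
assert (nzp : ~ par z p) by (intros ?; apply zp; now apply (circle_par_eq K')).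
assert (nzc : ~ par z c) by eauto using par_trans, par_sym.
assert (nzb : ~ par z b).
{ intros zb. apply qq1. transitivity z.
  - apply (circle_par_eq K'); eauto using par_trans, par_sym.
  - apply (circle_par_eq K1'); eauto using par_trans, par_sym. }
assert (nzq : ~ par z q) by eauto using par_trans, par_sym.
assert (nzq1 : ~ par z q1) by eauto using par_trans, par_sym.
destruct (circle_through b p z) as (M & CM & Mb & Mp & Mz); auto using par_sym.
destruct (circle_through c q z) as (N & CN & Nc & Nq & Nz); auto using par_sym.
destruct (circle_through c q1 z) as (N1 & CN1 & N1c & N1q1 & N1z);
  auto using par_sym.
assert (NN1 : ~ same_set N N1).
{ intros E. apply qq1. apply (circle_par_eq N); trivial; [now apply E|].
  eauto using par_trans, par_sym. }
assert (nMc : ~ M c) by (intros ?; apply dpc; now apply (circle_par_eq M)).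
(* The circle through c, s, z would contain both q and q1, which are parallel and distinct. *)
assert (MK : forall s, M s -> K s -> s <> b -> s = z).
{ intros s Ms Ks sb. apply NNPP; intros sz.
  assert (ns : forall J, C J -> J s -> J z -> ~ par s z).
  { intros J CJ Js Jz E. apply sz. now apply (circle_par_eq J). }
  destruct (miquel_join Hc CM Mb Mp s z) as (J & CJ & Jc & Jq & Js & Jz); auto.
  destruct (miquel_join Hc1 CM Mb Mp s z) as (J1 & CJ1 & J1c & J1q & J1s & J1z);
    auto.
  apply qq1. apply (circle_par_eq J); eauto using par_trans, par_sym.
  apply (circle_eq J J1 c s z); auto using not_par_neq, par_sym.
  now intros ->. }
(* By the swapped transfer, a second common point of M and N or N1 lies on K, contrary to [MK]. *)
apply NN1. apply (tangent_unique M N N1 z c); trivial.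
- intros s Ms Ns. apply NNPP; intros sz. apply sz, MK; trivial.
  + apply (miquel_transfer (config_swap _ _ _ _ _ _ _ _ _ _ Hc) CM Mp Mb z s N);
      trivial.
  + intros ->. apply dqb. now apply (circle_par_eq N).
- intros s Ms N1s. apply NNPP; intros sz. apply sz, MK; trivial.
  + apply (miquel_transfer (config_swap _ _ _ _ _ _ _ _ _ _ Hc1) CM Mp Mb
      z s N1); trivial.
  + intros ->. apply dq1b. now apply (circle_par_eq N1).
Qed.

End Plane.

Theorem theorem2p3 (P : Type) (C : pset P -> Prop) (par : P -> P -> Prop)
  (HL : laguerre_plane C par) (HM : miquelian C par)
  (a b c x p q : P)
  (Kabc Kabx Kacx Kqpx : pset P)
  (Habcx : ~ par a b /\ ~ par a c /\ ~ par a x /\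
           ~ par b c /\ ~ par b x /\ ~ par c x)
  (HKabc : C Kabc /\ Kabc a /\ Kabc b /\ Kabc c)
  (HxK : ~ Kabc x)
  (HKabx : C Kabx /\ Kabx a /\ Kabx b /\ Kabx x)
  (HKacx : C Kacx /\ Kacx a /\ Kacx c /\ Kacx x)
  (Hp : par p c /\ Kabx p)
  (Hq : par q b /\ Kacx q)
  (HKqpx : C Kqpx /\ Kqpx q /\ Kqpx p /\ Kqpx x) :
  forall L : pset P, C L -> tangent_at L Kqpx p -> L b -> tangent_at L Kabc b.
Proof.
intros L CL (Lp & _ & HL') Lb.
assert (Hc : config (C := C) (par := par) a b c x p q Kabc Kqpx Kabx Kacx)
  by (constructor; tauto).
destruct (config_derived HL _ _ _ _ _ _ _ _ _ _ Hc).
(* L is not (q,p,x) itself, since that circle does not contain b. *)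
destruct HL' as [HL'|E]; [|now apply E in Lb].
split; [|split]; [tauto|tauto|left].
intros z; split; [|intros ->; tauto].
intros [Lz Kz].
apply (pencil_circle_tangent HL HM a b c x p q Kabc Kqpx Kabx Kacx L);
  trivial.
intros y Ly K'y. now apply HL'.
Qed.
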